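(* Let $(H,\omega)$ be a pivotal Hopf algebra over $\Bbbk$. Then $(H,\omega)$ is spherical if and only if, for every finite-dimensional simple (irreducible) $H$-module $S$ and every $\vartheta\in \operatorname{End}_H(S)$, one has $\operatorname{tr}_S(\vartheta\omega)=\operatorname{tr}_S(\vartheta\omega^{-1})$.
   Context: $\Bbbk$ is an algebraically closed field of characteristic $0$. All Hopf algebras are over $\Bbbk$ and have bijective antipode $\mathcal S$. $G(H)$ denotes the group of group-like elements of $H$, and $\operatorname{Rep} H$ the category of finite-dimensional $H$-modules. A pivot of $H$ is an element $\omega\in G(H)$ such that $\mathcal S^2(x)=\omega x\omega^{-1}$ for all $x\in H$. A pivotal Hopf algebra is a pair $(H,\omega)$ with $\omega$ a pivot of $H$. A pivotal Hopf algebra $(H,\omega)$ is spherical if $\operatorname{tr}_V(\vartheta\omega)=\operatorname{tr}_V(\vartheta\omega^{-1})$ for all $V\in\operatorname{Rep}H$ and all $\vartheta\in\operatorname{End}_H(V)$. Here $\operatorname{tr}_V$ is the ordinary trace of linear endomorphisms of $V$, and $\vartheta\omega$ denotes the linear map $v\mapsto\vartheta(\omega\cdot v)$. *)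

(* Defs.v *)
From HB Require Import structures.
From mathcomp Require Import all_boot all_order all_algebra.
From mathcomp Require Import boolp.

Set Implicit Arguments.
Unset Strict Implicit.
Unset Printing Implicit Defensive.

Import GRing.Theory.
Local Open Scope ring_scope.
Local Open Scope quotient_scope.

Reserved Notation "v \ox w" (at level 40, left associativity).

Notation bilinear_map := (bilinear_for *:%R *:%R).

(* V (x) W is the quotient of the formal sums v1.w1 + ... + vn.wn, encoded as
   lists of pairs, that identifies two sums when every bilinear map out of
   V * W takes the same value on both. *)
Section TensorType.
Variables (k : fieldType) (V W : lmodType k).

Definition fsum (U : lmodType k) (b : V -> W -> U) (s : seq (V * W)) : U :=
  \sum_(p <- s) b p.1 p.2.

Definition tensor_rel (s t : seq (V * W)) : bool :=
  `[< forall (U : lmodType k) (b : V -> W -> U),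
        bilinear_map b -> fsum b s = fsum b t >].

Lemma tensor_rel_refl : reflexive tensor_rel.
Proof. by move=> s; apply/asboolP. Qed.

Lemma tensor_rel_sym : symmetric tensor_rel.
Proof.
by move=> s t; apply/asboolP/asboolP => st U b bb; rewrite (st U b bb).
Qed.

Lemma tensor_rel_trans : transitive tensor_rel.
Proof.
move=> t s u /asboolP st /asboolP tu; apply/asboolP => U b bb.
by rewrite (st U b bb) (tu U b bb).
Qed.

Canonical tensor_equiv :=
  EquivRel tensor_rel tensor_rel_refl tensor_rel_sym tensor_rel_trans.

Definition tensor : Type := {eq_quot tensor_equiv}.
HB.instance Definition _ := Choice.on tensor.
HB.instance Definition _ := EqQuotient.on tensor.

End TensorType.

Definition tpure {k : fieldType} {V W : lmodType k} (v : V) (w : W)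
  : tensor V W := \pi_(tensor V W) [:: (v, w)].
Notation "v \ox w" := (tpure v w) : ring_scope.

(* For a bilinear b, the linear map V (x) W -> U that b induces (tlift_pure,
   tlift_linear). It depends on the choice of repr if b is not bilinear. *)
Definition tlift {k : fieldType} {V W U : lmodType k} (b : V -> W -> U)
  (t : tensor V W) : U := fsum b (repr t).

Section TensorLmod.
Variables (k : fieldType) (V W : lmodType k).
Implicit Types (s : seq (V * W)) (t u : tensor V W).

Lemma fsum_cat (U : lmodType k) (b : V -> W -> U) s1 s2 :
  fsum b (s1 ++ s2) = fsum b s1 + fsum b s2.
Proof. exact: big_cat. Qed.

Definition fscale (a : k) s := [seq (a *: p.1, p.2) | p <- s].

Lemma fsum_scale (U : lmodType k) (b : V -> W -> U) a s :
  bilinear_map b -> fsum b (fscale a s) = a *: fsum b s.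
Proof.
move=> [bl _]; rewrite /fsum big_map scaler_sumr; apply: eq_bigr => p _ /=.
have b0 : b 0 p.2 = 0.
  have /= := bl p.2 (-1) 0 0.
  by rewrite scaler0 add0r scaleN1r addNr.
by have /= := bl p.2 a p.1 0; rewrite !addr0 b0 addr0.
Qed.

Lemma tensorP s t :
  \pi_(tensor V W) s = t <->
  forall (U : lmodType k) (b : V -> W -> U), bilinear_map b ->
    fsum b s = tlift b t.
Proof.
rewrite -{1}[t]reprK; split=> [/eqmodP/asboolP//|h].
by apply/eqmodP/asboolP.
Qed.

Lemma tlift_pi (U : lmodType k) (b : V -> W -> U) s :
  bilinear_map b -> tlift b (\pi_(tensor V W) s) = fsum b s.
Proof. by move=> bb; rewrite -((tensorP s _).1 erefl U b bb). Qed.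

Lemma tensor_eqP t u :
  (forall (U : lmodType k) (b : V -> W -> U), bilinear_map b ->
    tlift b t = tlift b u) -> t = u.
Proof. by move=> h; rewrite -[t]reprK; apply: (tensorP _ _).2. Qed.

Definition tzero : tensor V W := \pi_(tensor V W) [::].
Definition tadd t u : tensor V W := \pi_(tensor V W) (repr t ++ repr u).
Definition tscale (a : k) t : tensor V W := \pi_(tensor V W) (fscale a (repr t)).
Definition topp t := tscale (-1) t.

Lemma tlift_tzero (U : lmodType k) (b : V -> W -> U) :
  bilinear_map b -> tlift b tzero = 0.
Proof. by move=> bb; rewrite tlift_pi// /fsum big_nil. Qed.

Lemma tlift_tadd (U : lmodType k) (b : V -> W -> U) t u :
  bilinear_map b -> tlift b (tadd t u) = tlift b t + tlift b u.
Proof. by move=> bb; rewrite tlift_pi// fsum_cat. Qed.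

Lemma tlift_tscale (U : lmodType k) (b : V -> W -> U) a t :
  bilinear_map b -> tlift b (tscale a t) = a *: tlift b t.
Proof. by move=> bb; rewrite tlift_pi// fsum_scale. Qed.

Let tliftD := (tlift_tzero, tlift_tadd, tlift_tscale).

Lemma taddA : associative tadd.
Proof.
by move=> t u v; apply: tensor_eqP => U b bb; rewrite !tliftD// addrA.
Qed.

Lemma taddC : commutative tadd.
Proof. by move=> t u; apply: tensor_eqP => U b bb; rewrite !tliftD// addrC. Qed.

Lemma tadd0 : left_id tzero tadd.
Proof. by move=> t; apply: tensor_eqP => U b bb; rewrite !tliftD// add0r. Qed.

Lemma taddN : left_inverse tzero topp tadd.
Proof.
move=> t; apply: tensor_eqP => U b bb.
by rewrite !tliftD// scaleN1r addNr.
Qed.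

HB.instance Definition _ :=
  GRing.isZmodule.Build (tensor V W) taddA taddC tadd0 taddN.

Lemma tscaleA a a' t : tscale a (tscale a' t) = tscale (a * a') t.
Proof. by apply: tensor_eqP => U b bb; rewrite !tliftD// scalerA. Qed.

Lemma tscale1 : left_id 1 tscale.
Proof. by move=> t; apply: tensor_eqP => U b bb; rewrite !tliftD// scale1r. Qed.

Lemma tscaleDr : right_distributive tscale +%R.
Proof.
by move=> a t u; apply: tensor_eqP => U b bb; rewrite !tliftD// scalerDr.
Qed.

Lemma tscaleDl t : {morph tscale^~ t : a a' / a + a'}.
Proof.
by move=> a a'; apply: tensor_eqP => U b bb; rewrite !tliftD// scalerDl.
Qed.

HB.instance Definition _ := GRing.Zmodule_isLmodule.Build k (tensor V W)
  tscaleA tscale1 tscaleDr tscaleDl.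

Lemma tlift_pure (U : lmodType k) (b : V -> W -> U) v w :
  bilinear_map b -> tlift b (v \ox w) = b v w.
Proof. by move=> bb; rewrite tlift_pi// /fsum big_seq1. Qed.

Lemma tlift_linear (U : lmodType k) (b : V -> W -> U) :
  bilinear_map b -> linear (tlift b).
Proof. by move=> bb a t u; rewrite tlift_tadd// tlift_tscale. Qed.

Lemma tpure_bilinear : bilinear_map (@tpure k V W).
Proof.
split=> [w a v v'|v a w w']; apply: tensor_eqP => U b bb.
  by rewrite tlift_linear// !tlift_pure// bb.1.
by rewrite tlift_linear// !tlift_pure// bb.2.
Qed.

Lemma tensor_sumE t : t = \sum_(p <- repr t) p.1 \ox p.2.
Proof.
apply: tensor_eqP => U b bb; rewrite {1}/tlift /fsum.
elim: (repr t) => [|p s IHs]; first by rewrite !big_nil tlift_tzero.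
by rewrite !big_cons tlift_tadd// tlift_pure// IHs.
Qed.

Lemma tensor_ext (U : lmodType k) (f g : tensor V W -> U) :
  linear f -> linear g -> (forall v w, f (v \ox w) = g (v \ox w)) -> f =1 g.
Proof.
move=> lf lg fg t.
pose F : {linear tensor V W -> U} := HB.pack f (GRing.isLinear.Build _ _ _ _ f lf).
pose G : {linear tensor V W -> U} := HB.pack g (GRing.isLinear.Build _ _ _ _ g lg).
rewrite -[f]/(F : _ -> _) -[g]/(G : _ -> _) [t]tensor_sumE !linear_sum.
by apply: eq_bigr => p _; apply: fg.
Qed.

End TensorLmod.

Definition tmap {k : fieldType} {V W V' W' : lmodType k}
  (f : V -> V') (g : W -> W') : tensor V W -> tensor V' W' :=
  tlift (fun v w => f v \ox g w).

Definition tassoc {k : fieldType} {U V W : lmodType k} :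
    tensor (tensor U V) W -> tensor U (tensor V W) :=
  tlift (fun t w => tlift (fun u v => u \ox (v \ox w)) t).

Lemma tmap_pure (k : fieldType) (V W V' W' : lmodType k)
    (f : V -> V') (g : W -> W') v w :
  linear f -> linear g -> tmap f g (v \ox w) = f v \ox g w.
Proof.
move=> lf lg; rewrite /tmap tlift_pure//.
split=> [y a x x'|x a y y'] /=; first by rewrite lf (tpure_bilinear _ _).1.
by rewrite lg (tpure_bilinear _ _).2.
Qed.

Lemma tassoc_pure (k : fieldType) (U V W : lmodType k) (u : U) (v : V) (w : W) :
  tassoc ((u \ox v) \ox w) = u \ox (v \ox w).
Proof.
have bb (w' : W) : bilinear_map (fun (u : U) (v : V) => u \ox (v \ox w')).
  split=> [y a x x'|x a y y'] /=; first by rewrite (tpure_bilinear _ _).1.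
  by rewrite (tpure_bilinear _ _).1 (tpure_bilinear _ _).2.
rewrite /tassoc !tlift_pure//; split=> [y a t t'|t a y y'] /=.
  exact: (tlift_linear (bb y)).
rewrite /tlift /fsum scaler_sumr -big_split /=; apply: eq_bigr => p _.
by rewrite !(tpure_bilinear _ _).2.
Qed.

Section TensorAlg.
Variables (k : fieldType) (A B : algType k).
Implicit Types (t u : tensor A B).

Definition tmul t u : tensor A B :=
  tlift (fun a b => tlift (fun c d => (a * c) \ox (b * d)) u) t.

Definition tone : tensor A B := 1 \ox 1.

Lemma tmul_bilin_r a b :
  bilinear_map (fun (c : A) (d : B) => (a * c) \ox (b * d)).
Proof.
split=> [d x c c'|c x d d'] /=.
  by rewrite mulrDr -scalerAr (tpure_bilinear _ _).1.
by rewrite mulrDr -scalerAr (tpure_bilinear _ _).2.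
Qed.

Lemma tmul_bilin_l u :
  bilinear_map
    (fun (a : A) (b : B) => tlift (fun c d => (a * c) \ox (b * d)) u).
Proof.
split=> [b x a a'|a x b b'] /=; rewrite /tlift /fsum scaler_sumr -big_split /=;
  apply: eq_bigr => p _; rewrite mulrDl -scalerAl.
  by rewrite (tpure_bilinear _ _).1.
by rewrite (tpure_bilinear _ _).2.
Qed.

Lemma tmul_pure a b c d : tmul (a \ox b) (c \ox d) = (a * c) \ox (b * d).
Proof.
rewrite /tmul tlift_pure; last exact: tmul_bilin_l.
by rewrite tlift_pure//; apply: tmul_bilin_r.
Qed.

Lemma tmul_linear_l u : linear (tmul^~ u).
Proof. exact/tlift_linear/tmul_bilin_l. Qed.

Lemma tmul_linear_r t : linear (tmul t).
Proof.
move=> x u u'; rewrite /tmul /tlift /fsum scaler_sumr -big_split /=.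
by apply: eq_bigr => p _; apply: (tlift_linear (tmul_bilin_r p.1 p.2)).
Qed.

Lemma tmulDl : left_distributive tmul +%R.
Proof. by move=> t t' u; have := tmul_linear_l u 1 t t'; rewrite !scale1r. Qed.

Lemma tmulDr : right_distributive tmul +%R.
Proof. by move=> t u u'; have := tmul_linear_r t 1 u u'; rewrite !scale1r. Qed.

Lemma tmul1 : left_id tone tmul.
Proof.
apply: tensor_ext => [||a b]; [exact: tmul_linear_r | by move=> ? | ].
by rewrite tmul_pure !mul1r.
Qed.

Lemma t1mul : right_id tone tmul.
Proof.
apply: tensor_ext => [||a b]; [exact: tmul_linear_l | by move=> ? | ].
by rewrite tmul_pure !mulr1.
Qed.

Lemma tmulA : associative tmul.
Proof.
move=> t u v; move: v; apply: tensor_ext => [||e f].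
- by move=> x v v'; rewrite !tmul_linear_r.
- by move=> x v v'; rewrite !tmul_linear_r.
move: u; apply: tensor_ext => [||c d].
- by move=> x v v'; rewrite tmul_linear_l tmul_linear_r.
- by move=> x v v'; rewrite tmul_linear_r tmul_linear_l.
move: t; apply: tensor_ext => [||a b].
- by move=> x v v'; rewrite tmul_linear_l.
- by move=> x v v'; rewrite !tmul_linear_l.
by rewrite !tmul_pure !mulrA.
Qed.

HB.instance Definition _ := GRing.Zmodule_isPzRing.Build (tensor A B)
  tmulA tmul1 t1mul tmulDl tmulDr.

End TensorAlg.

HB.mixin Record Algebra_isHopf (k : fieldType) H of GRing.Algebra k H := {
  comult : H -> tensor H H;
  counit : H -> k;
  antipode : H -> H;
  comult_linear : linear comult;
  comult_monoid_morphism : monoid_morphism comult;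
  counit_scalar : scalar counit;
  counit_monoid_morphism : monoid_morphism counit;
  antipode_linear : linear antipode;
  comultA : forall h : H,
    tassoc (tmap comult id (comult h)) = tmap id comult (comult h);
  counitl : forall h : H, tlift (fun x y : H => counit x *: y) (comult h) = h;
  counitr : forall h : H, tlift (fun x y : H => counit y *: x) (comult h) = h;
  antipodel : forall h : H,
    tlift (fun x y : H => antipode x * y) (comult h) = (counit h)%:A;
  antipoder : forall h : H,
    tlift (fun x y : H => x * antipode y) (comult h) = (counit h)%:A
}.

#[short(type="hopfAlgType")]
HB.structure Definition Hopf (k : fieldType) :=
  {H of GRing.Algebra k H & Algebra_isHopf k H}.

Section Grouplike.
Variables (k : fieldType) (H : hopfAlgType k).
Implicit Types g h : H.

Definition is_grouplike g : Prop := comult g = g \ox g /\ counit g = 1.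

Lemma grouplike1 : is_grouplike 1.
Proof. by split; [apply: comult_monoid_morphism.1 | apply: counit_monoid_morphism.1]. Qed.

Lemma grouplikeM g h : is_grouplike g -> is_grouplike h -> is_grouplike (g * h).
Proof.
move=> [dg eg] [dh eh]; split.
  by rewrite comult_monoid_morphism.2 dg dh [LHS]tmul_pure.
by rewrite counit_monoid_morphism.2 eg eh mulr1.
Qed.

Lemma grouplikeVl g : is_grouplike g -> antipode g * g = 1.
Proof.
move=> [dg eg]; have := antipodel g; rewrite dg eg scale1r tlift_pure//.
split=> [y a x x'|x a y y'] /=; first by rewrite antipode_linear mulrDl scalerAl.
by rewrite mulrDr scalerAr.
Qed.

Lemma grouplikeVr g : is_grouplike g -> g * antipode g = 1.
Proof.
move=> [dg eg]; have := antipoder g; rewrite dg eg scale1r tlift_pure//.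
split=> [y a x x'|x a y y'] /=; first by rewrite mulrDl scalerAl.
by rewrite antipode_linear mulrDr scalerAr.
Qed.

Lemma grouplikeV g : is_grouplike g -> is_grouplike (antipode g).
Proof.
move=> gg; have [dg eg] := gg; split; last first.
  have := congr1 (@counit k H) (grouplikeVl gg).
  by rewrite counit_monoid_morphism.2 counit_monoid_morphism.1 eg mulr1.
have l : comult (antipode g) * comult g = 1.
  by rewrite -comult_monoid_morphism.2 grouplikeVl// comult_monoid_morphism.1.
have r : comult g * (antipode g \ox antipode g) = 1.
  by rewrite dg [LHS]tmul_pure grouplikeVr.
by rewrite -[LHS]mulr1 -r mulrA l mul1r.
Qed.

(* G(H) *)
Record grouplike := Grouplike {
  gl_val :> H;
  gl_prop : `[< is_grouplike gl_val >]
}.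

HB.instance Definition _ := [isSub for gl_val].
HB.instance Definition _ := [Choice of grouplike by <:].

Lemma grouplikeP (g : grouplike) : is_grouplike g.
Proof. exact/asboolP/gl_prop. Qed.

Definition gl_one : grouplike := Grouplike (asboolT grouplike1).
Definition gl_mul (g h : grouplike) : grouplike :=
  Grouplike (asboolT (grouplikeM (grouplikeP g) (grouplikeP h))).
Definition gl_inv (g : grouplike) : grouplike :=
  Grouplike (asboolT (grouplikeV (grouplikeP g))).

Lemma gl_mulA : associative gl_mul.
Proof. by move=> x y z; apply/val_inj/mulrA. Qed.
Lemma gl_mul1 : left_id gl_one gl_mul.
Proof. by move=> x; apply/val_inj/mul1r. Qed.
Lemma gl_1mul : right_id gl_one gl_mul.
Proof. by move=> x; apply/val_inj/mulr1. Qed.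
Lemma gl_mulV : left_inverse gl_one gl_inv gl_mul.
Proof. by move=> x; apply/val_inj/grouplikeVl/grouplikeP. Qed.
Lemma gl_Vmul : right_inverse gl_one gl_inv gl_mul.
Proof. by move=> x; apply/val_inj/grouplikeVr/grouplikeP. Qed.

HB.instance Definition _ :=
  isGroup.Build grouplike gl_mulA gl_mul1 gl_1mul gl_mulV gl_Vmul.

End Grouplike.

Definition is_pivot {k : fieldType} {H : hopfAlgType k} (w : grouplike H) :=
  forall x : H, antipode (antipode x) = gl_val w * x * gl_val w^-1%g.

Definition lftrace {k : fieldType} {V : vectType k} (f : 'End(V)) : k :=
  \tr (passmx.mxof (vbasis {:V}) (vbasis {:V}) f).

Record fdmodule (k : fieldType) (H : algType k) := FDModule {
  fdmod_sort :> vectType k;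
  act : H -> 'End(fdmod_sort);
  act_linear : linear act;
  act1 : act 1 = \1%VF;
  actM : forall x y : H, act (x * y) = (act x \o act y)%VF
}.

Section Modules.
Variables (k : fieldType) (H : algType k).
Implicit Type V : fdmodule H.

Definition is_modEnd V (f : 'End(V)) : Prop :=
  forall x : H, (f \o act V x = act V x \o f)%VF.

Definition is_submod V (U : {vspace V}) : Prop :=
  forall x : H, (act V x @: U <= U)%VS.

Definition simple_mod V : Prop :=
  ({:V} != 0)%VS /\
  forall U : {vspace V}, is_submod U -> U = 0%VS \/ U = {:V}%VS.

End Modules.

Definition is_spherical {k : fieldType} {H : hopfAlgType k} (w : grouplike H) :=
  forall (V : fdmodule H) (f : 'End(V)), is_modEnd f ->
    lftrace (f \o act V (gl_val w))%VF = lftrace (f \o act V (gl_val w^-1%g))%VF.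

(* Main.v *)
Require Import Defs.
From HB Require Import structures.
From mathcomp Require Import all_boot all_order all_algebra.
From mathcomp Require Import boolp.

Set Implicit Arguments.
Unset Strict Implicit.
Unset Printing Implicit Defensive.

Import GRing.Theory.
Local Open Scope ring_scope.

(* Dévissage: if U is a submodule of V stable under f, then f induces module
   endomorphisms of U and V/U, and the traces of f a (a in H) add up. Since k is
   algebraically closed, a nonzero V without proper nonzero f-stable submodule
   equals an eigenspace of f; then f is a scalar, every submodule is f-stable,
   and V is simple. Induction on dim V concludes. *)

Section LinearAlgebra.
Variable k : fieldType.
Implicit Types V W : vectType k.

Lemma lftraceD V (f g : 'End(V)) : lftrace (f + g) = lftrace f + lftrace g.
Proof. by rewrite -[f]scale1r /lftrace passmx.mxof_linear !scale1r mxtraceD. Qed.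

Lemma lftraceC V W (f : 'Hom(W, V)) (g : 'Hom(V, W)) :
  lftrace (f \o g)%VF = lftrace (g \o f)%VF.
Proof.
have bV := vbasisP {:V}; have bW := vbasisP {:W}.
by rewrite /lftrace (passmx.mxof_comp _ _ bW) (passmx.mxof_comp _ _ bV) mxtrace_mulC.
Qed.

Lemma lftrace_dim0 V (f : 'End(V)) : \dim {:V} = 0%N -> lftrace f = 0.
Proof.
by move=> V0; apply: big1 => i _; have := ltn_ord i; rewrite {2}V0.
Qed.

Lemma subv_lfunP V W (f : 'Hom(V, W)) (U : {vspace V}) (U' : {vspace W}) :
  reflect (forall u, u \in U -> f u \in U') (f @: U <= U')%VS.
Proof.
apply: (iffP subvP) => [sU u uU|sU _ /memv_imgP[u uU ->]]; last exact: sU.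
by rewrite sU ?memv_img.
Qed.

Lemma memv_leigenspace V (f : 'End(V)) c v :
  (v \in passmx.leigenspace f c) = (f v == c *: v).
Proof. by rewrite memv_ker add_lfunE opp_lfunE scale_lfunE id_lfunE subr_eq0. Qed.

End LinearAlgebra.

(** The characteristic polynomial has degree [\dim {:V} > 0], hence a root in [k]; a row eigenvector
    for that root holds the coordinates of an eigenvector of [f]. *)
Lemma leigenvalue_exists (k : closedFieldType) (V : vectType k) (f : 'End(V)) :
  ({:V} != 0)%VS -> exists a, passmx.leigenvalue f a.
Proof.
rewrite -dimv_eq0 => V_neq0.
pose M := passmx.mxof (vbasis {:V}) (vbasis {:V}) f.
have /closed_rootP[a] : size (char_poly M) != 1%N by rewrite size_char_poly.
rewrite -eigenvalue_root_char => /eigenvalueP[v vM v_neq0]; exists a.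
have bV := vbasisP {:V}.
apply: contraNneq v_neq0 => E0.
rewrite -(passmx.vecof_eq0 bV) -memv0 -E0 memv_leigenspace.
by rewrite (passmx.hom_vecof _ bV) vM /passmx.vecof scaler_sumr;
  apply/eqP/eq_bigr => l _; rewrite mxE scalerA.
Qed.

(* For a decomposition V = X + Y with injections i, j and projections p, q,
   the equation q g i = 0 says that g preserves X; then p g i and q g j are the
   endomorphisms that g induces on X and on V/X. *)
Section Compression.
Variables (k : fieldType) (V X Y : vectType k).
Variables (i : 'Hom(X, V)) (p : 'Hom(V, X)) (j : 'Hom(Y, V)) (q : 'Hom(V, Y)).
Hypothesis ip_jq : ((i \o p) + (j \o q) = \1)%VF.
Implicit Types g h : 'End(V).

Definition compress (T T' : vectType k) (s : 'Hom(T, V)) (r : 'Hom(V, T')) g :=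
  (r \o g \o s)%VF.

(** Block multiplication: the identity [i p + j q] is inserted between [f] and [h]. *)
Lemma comp_lfun_split (T T' : vectType k) (f : 'Hom(V, T)) (h : 'Hom(T', V)) :
  (f \o h = ((f \o i) \o (p \o h)) + ((f \o j) \o (q \o h)))%VF.
Proof.
rewrite -[h in LHS]comp_lfun1l -ip_jq comp_lfunDl comp_lfunDr.
by rewrite !comp_lfunA.
Qed.

(** In [p g h i = (p g i)(p h i) + (p g j)(q h i)] the last factor vanishes, as the right-hand map
    [h] preserves X. *)
Lemma compressM_sub g h : compress i q h = 0 ->
  compress i p (g \o h)%VF = (compress i p g \o compress i p h)%VF.
Proof.
rewrite /compress -!comp_lfunA => h0.
by rewrite comp_lfunA comp_lfun_split h0 comp_lfun0r addr0 -!comp_lfunA.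
Qed.

(** In [q g h j = (q g i)(p h j) + (q g j)(q h j)] it is now the left-hand map [g] that has to
    preserve X. *)
Lemma compressM_quot g h : compress i q g = 0 ->
  compress j q (g \o h)%VF = (compress j q g \o compress j q h)%VF.
Proof.
rewrite /compress => g0.
rewrite comp_lfunA -comp_lfunA comp_lfun_split g0 comp_lfun0l add0r.
by rewrite !comp_lfunA.
Qed.

(** The trace is the sum of the traces of the diagonal blocks: [g = g i p + g j q], and cyclicity
    moves [p] and [q] to the front. *)
Lemma lftrace_compress g :
  lftrace g = lftrace (compress i p g) + lftrace (compress j q g).
Proof.
rewrite -[g in LHS]comp_lfun1r -ip_jq comp_lfunDr lftraceD !comp_lfunA.
by rewrite lftraceC [X in _ + X]lftraceC /compress !comp_lfunA.
Qed.

End Compression.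
Arguments compress {k V T T'} s r g : rename.

(** The quotient V/U is modelled on the vector space complement [U^C], with [q] in the role of the
    quotient map. *)
Lemma subvs_complement (k : fieldType) (V : vectType k) (U : {vspace V}) :
  exists (i : 'Hom(subvs_of U, V)) (p : 'Hom(V, subvs_of U))
         (j : 'Hom(subvs_of U^C, V)) (q : 'Hom(V, subvs_of U^C)),
    [/\ (p \o i = \1)%VF, (q \o j = \1)%VF, ((i \o p) + (j \o q) = \1)%VF &
        forall g : 'End(V), (g @: U <= U)%VS -> compress i q g = 0].
Proof.
pose iU : 'Hom(subvs_of U, V) := linfun vsval.
pose pU : 'Hom(V, subvs_of U) := linfun (vsproj U).
pose iW : 'Hom(subvs_of U^C, V) := linfun vsval.
have iE u : iU u = vsval u by rewrite lfunE.
have jE u : iW u = vsval u by rewrite lfunE.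
have pE v : pU v = vsproj U v by rewrite lfunE.
have ipE v : vsval (vsproj U v) = projv U v by rewrite unlock.
(* [vsproj U^C] alone has kernel [(U^C)^C], which may differ from [U]; subtracting the component in
   [U] first makes [q] vanish on [U]. *)
have [q qE] : exists q : 'Hom(V, subvs_of U^C),
    forall v, q v = vsproj U^C (v - projv U v).
  exists (linfun (vsproj U^C) \o (\1 - (iU \o pU)))%VF => v.
  by rewrite comp_lfunE add_lfunE opp_lfunE comp_lfunE id_lfunE iE pE ipE lfunE.
exists iU, pU, iW, q; split.
- by apply/lfunP => u; rewrite comp_lfunE iE pE vsvalK id_lfunE.
- apply/lfunP => u; rewrite comp_lfunE id_lfunE qE jE.
  have -> : projv U (vsval u) = 0.
    by apply/eqP; rewrite -memv_ker lker_proj subvsP.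
  by rewrite subr0 vsvalK.
- apply/lfunP => v; rewrite add_lfunE !comp_lfunE qE iE jE pE ipE id_lfunE.
  by rewrite vsprojK ?memv_projC// addrC subrK.
- move=> g /subv_lfunP gU; apply/lfunP => u; rewrite /compress !comp_lfunE qE iE.
  by rewrite projv_id ?gU ?subvsP// subrr linear0 lfunE.
Qed.

Section Devissage.
Variables (k : fieldType) (H : algType k).

Lemma compress_act_linear (V : fdmodule H) (X : vectType k)
  (i : 'Hom(X, V)) (p : 'Hom(V, X)) : linear (fun x => compress i p (act V x)).
Proof.
move=> a x y; rewrite act_linear /compress comp_lfunDr comp_lfunDl.
by rewrite -comp_lfunZr -comp_lfunZl.
Qed.

Lemma compress_act1 (V : fdmodule H) (X : vectType k)
  (i : 'Hom(X, V)) (p : 'Hom(V, X)) :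
  (p \o i = \1)%VF -> compress i p (act V 1) = \1%VF.
Proof. by rewrite /compress act1 comp_lfun1r. Qed.

(** This serves both for U and for V/U, where [M] comes from [compressM_sub] and [compressM_quot]
    respectively. *)
Definition compress_mod (V : fdmodule H) (X : vectType k)
    (i : 'Hom(X, V)) (p : 'Hom(V, X)) (pi : (p \o i = \1)%VF)
    (M : forall x y, compress i p (act V (x * y)) =
      (compress i p (act V x) \o compress i p (act V y))%VF) : fdmodule H :=
  FDModule (compress_act_linear i p) (compress_act1 pi) M.

(* The witnesses are the submodule U and the quotient V/U. *)
Lemma lftrace_devissage (V : fdmodule H) (f : 'End(V)) (U : {vspace V}) :
  is_modEnd f -> is_submod U -> (f @: U <= U)%VS ->
  exists (X Y : fdmodule H) (fX : 'End(X)) (fY : 'End(Y)),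
    [/\ is_modEnd fX /\ is_modEnd fY,
        \dim {:X} = \dim U, \dim {:Y} = (\dim {:V} - \dim U)%N &
        forall a, lftrace (f \o act V a)%VF =
                  lftrace (fX \o act X a)%VF + lftrace (fY \o act Y a)%VF].
Proof.
move=> fH UH fU; have [i [p [j [q [pi qj ip_jq sU]]]]] := subvs_complement U.
have cX x y : compress i p (act V (x * y)) =
    (compress i p (act V x) \o compress i p (act V y))%VF.
  by rewrite actM (compressM_sub ip_jq)// sU.
have cY x y : compress j q (act V (x * y)) =
    (compress j q (act V x) \o compress j q (act V y))%VF.
  by rewrite actM (compressM_quot ip_jq)// sU.
exists (compress_mod pi cX), (compress_mod qj cY), (compress i p f),
  (compress j q f); split.
(* Compression is multiplicative on maps preserving [U], so the commutation of [f] with the action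
   is inherited. *)
- split=> x /=.
    by rewrite -!(compressM_sub ip_jq) ?sU// fH.
  by rewrite -!(compressM_quot ip_jq) ?sU// fH.
- by rewrite dimvf.
- by rewrite dimvf /= [LHS]dimv_compl dimvf.
- move=> a /=; rewrite (lftrace_compress ip_jq).
  by rewrite (compressM_sub ip_jq) ?sU// (compressM_quot ip_jq) ?sU.
Qed.

Lemma leigenspace_submod (V : fdmodule H) (f : 'End(V)) (c : k) :
  is_modEnd f -> is_submod (passmx.leigenspace f c).
Proof.
move=> fH x; apply/subv_lfunP => v; rewrite !memv_leigenspace => /eqP fv.
by have /lfunP/(_ v) := fH x; rewrite !comp_lfunE => ->; rewrite fv linearZ.
Qed.

End Devissage.

Lemma simple_or_stable_submod (k : closedFieldType) (H : algType k)
    (V : fdmodule H) (f : 'End(V)) :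
  is_modEnd f -> ({:V} != 0)%VS ->
  simple_mod V \/
  exists U : {vspace V},
    [/\ is_submod U, (f @: U <= U)%VS, (U != 0)%VS & U != {:V}%VS].
Proof.
move=> fH V_neq0; have [c cP] := leigenvalue_exists f V_neq0.
have [Efull|Eproper] := eqVneq (passmx.leigenspace f c) {:V}%VS; last first.
  right; exists (passmx.leigenspace f c); split=> //.
    exact: leigenspace_submod.
  apply/subv_lfunP => v vE.
  by have := vE; rewrite memv_leigenspace => /eqP ->; apply: memvZ.
(* Here [f] is the scalar [c], so the absence of stable submodules becomes the absence of any proper
   nonzero submodule. *)
have stab (U : {vspace V}) : (f @: U <= U)%VS.
  apply/subv_lfunP => v vU.
  have /eqP -> : f v == c *: v by rewrite -memv_leigenspace Efull memvf.
  exact: memvZ.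
have [?|noU] := EM (exists U : {vspace V},
  [/\ is_submod U, (f @: U <= U)%VS, (U != 0)%VS & U != {:V}%VS]); first by right.
left; split=> // U UH.
have [->|U0] := eqVneq U 0%VS; first by left.
have [->|U1] := eqVneq U {:V}%VS; first by right.
by case: noU; exists U.
Qed.

Lemma lftrace_eq_simple (k : closedFieldType) (H : algType k) (a b : H) :
  (forall S : fdmodule H, simple_mod S -> forall f : 'End(S), is_modEnd f ->
     lftrace (f \o act S a)%VF = lftrace (f \o act S b)%VF) ->
  forall (V : fdmodule H) (f : 'End(V)), is_modEnd f ->
    lftrace (f \o act V a)%VF = lftrace (f \o act V b)%VF.
Proof.
move=> simpleE V; have [n] := ubnP (\dim {:V}).
elim: n V => // n IHn V; rewrite ltnS => leVn f fH.
(* The zero module is not simple and is treated apart: its traces are empty sums. *)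
have [V0|V_neq0] := eqVneq (\dim {:V}) 0%N; first by rewrite !lftrace_dim0.
rewrite dimv_eq0 in V_neq0.
have [/simpleE -> //|[U [UH fU U0 U1]]] := simple_or_stable_submod fH V_neq0.
have [X [Y [fX [fY [[fXH fYH] dX dY tE]]]]] := lftrace_devissage fH UH fU.
have ltUV : (\dim U < \dim {:V})%N.
  by rewrite ltnNge; apply: contraNN U1; rewrite eqEdim subvf.
have U_gt0 : (0 < \dim U)%N by rewrite lt0n dimv_eq0.
(* The dimension drops for X because [U] is proper, and for Y because [U] is nonzero. *)
rewrite !tE (IHn X _ fX)// ?(IHn Y _ fY)//.
  by rewrite dY (leq_trans _ leVn)// ltn_subrL U_gt0 lt0n dimv_eq0.
by rewrite dX (leq_trans ltUV).
Qed.

Theorem proposition2p1 (k : closedFieldType) (char0 : [pchar k] =i pred0)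
    (H : hopfAlgType k) (antipode_bij : bijective (@antipode k H))
    (w : grouplike H) (w_pivot : is_pivot w) :
  is_spherical w <->
  forall S : fdmodule H, simple_mod S ->
    forall f : 'End(S), is_modEnd f ->
      lftrace (f \o act S (gl_val w))%VF = lftrace (f \o act S (gl_val w^-1%g))%VF.
Proof.
split=> [sph S _ f|simpleE]; first exact: sph.
exact: lftrace_eq_simple.
Qed.
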